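(* $(k\langle A\rangle,\diamond,\tilde\Delta)$ is an infinitesimal Hopf algebra, with antipode $S_\diamond=-\Sigma^{-1}$.
   Context: Let $k$ be a field containing $\mathbb{Q}$, $A$ a countable set of ''letters'', $kA$ the $k$-vector space with basis $A$, and $\diamond$ an associative and commutative $k$-bilinear product on $kA$. Let $k\langle A\rangle$ be the $k$-vector space with basis the words $a_1a_2\cdots a_n$ ($a_i\in A$, $n\ge 0$), with concatenation product; $\ell(a_1\cdots a_n)=n$, and $1$ is the empty word. The product $\diamond$ is extended to a (noncommutative, associative) product on all of $k\langle A\rangle$ by $1\diamond w=w\diamond 1=w$ for all words $w$, and $w\diamond v=w'(a\diamond b)v'$ for nonempty words $w=w'a$, $v=bv'$ with $a,b$ letters. The deconcatenation coproduct is $\Delta(w)=\sum_{uv=w}u\otimes v$ (sum over all pairs of words $(u,v)$ with $uv=w$, including $(1,w)$ and $(w,1)$), and the reduced coproduct is $\tilde\Delta(1)=0$, $\tilde\Delta(w)=\Delta(w)-w\otimes1-1\otimes w$ for nonempty words $w$. Write $\tilde\Delta(w)=\sum_w w_{(1)}\otimes w_{(2)}$. That $(k\langle A\rangle,\diamond,\tilde\Delta)$ is an infinitesimal Hopf algebra means: $\diamond$ is associative, $\tilde\Delta$ is coassociative, $\tilde\Delta$ satisfies $$\tilde\Delta(w\diamond v)=\sum_v (w\diamond v_{(1)})\otimes v_{(2)}+\sum_w w_{(1)}\otimes(w_{(2)}\diamond v)\quad\text{for all } w,v,$$ and there is an antipode, i.e. a $k$-linear map $S_\diamond:k\langle A\rangle\to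 k\langle A\rangle$ with $$\sum_w S_\diamond(w_{(1)})\diamond w_{(2)}+S_\diamond(w)+w=0=\sum_w w_{(1)}\diamond S_\diamond(w_{(2)})+w+S_\diamond(w)\quad\text{for all } w.$$ $\Sigma:k\langle A\rangle\to k\langle A\rangle$ is the invertible linear map with $\Sigma(1)=1$ and $\Sigma(w)=\sum_{I}I[w]$ for nonempty words $w=a_1\cdots a_n$, the sum over all compositions $I=(i_1,\dots,i_m)$ of $n$ (sequences of positive integers with sum $n$), where $I[w]=(a_1\diamond\cdots\diamond a_{i_1})(a_{i_1+1}\diamond\cdots\diamond a_{i_1+i_2})\cdots(a_{i_1+\cdots+i_{m-1}+1}\diamond\cdots\diamond a_n)$. Its inverse is given by $\Sigma^{-1}(1)=1$, $\Sigma^{-1}(w)=\sum_{I}(-1)^{n-m}I[w]$. *)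

(* Defs.v *)
From HB Require Import structures.
From mathcomp Require Import all_boot all_order all_algebra.
From mathcomp Require Export finmap.
From mathcomp.multinomials Require Export monalg.

Set Implicit Arguments.
Unset Strict Implicit.
Unset Printing Implicit Defensive.

Import GRing.Theory.

Local Open Scope ring_scope.

(* {malg k[W]} is the k-vector space with basis W, and << w >> is the basis   *)
(* vector attached to w : W.                                                  *)

Section LinearExtension.
Variables (k : fieldType) (W : choiceType) (U : lmodType k).

Definition linext (f : W -> U) (x : {malg k[W]}) : U :=
  \sum_(w <- msupp x) x@_w *: f w.

Lemma linextEw f x (d : {fset W}) : (msupp x `<=` d)%fset ->
  linext f x = \sum_(w <- d) x@_w *: f w.
Proof.
move=> sxd; rewrite /linext (big_fset_incl _ sxd) // => w _ /mcoeff_outdom->.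
by rewrite scale0r.
Qed.

Lemma linext_is_linear f : linear (linext f).
Proof.
move=> c x y; pose d := (msupp x `|` msupp y)%fset.
have sx : (msupp x `<=` d)%fset by apply: fsubsetUl.
have sy : (msupp y `<=` d)%fset by apply: fsubsetUr.
have sxy : (msupp (c *: x + y) `<=` d)%fset.
  apply: (fsubset_trans (msuppD_le _ _)).
  by rewrite fsetSU // msuppZ_le.
rewrite (linextEw _ sx) (linextEw _ sy) (linextEw _ sxy) scaler_sumr -big_split.
by apply: eq_bigr => w _; rewrite mcoeffD mcoeffZ scalerDl scalerA.
Qed.

HB.instance Definition _ f :=
  GRing.isLinear.Build k {malg k[W]} U _ (linext f) (linext_is_linear f).

Lemma linextU f w : linext f << w >> = f w.
Proof.
rewrite (linextEw f (msuppU_le (k := w) (x := 1))) big_seq_fset1.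
by rewrite mcoeffUU scale1r.
Qed.

Lemma linext_lin c f g x :
  linext (fun w => c *: f w + g w) x = c *: linext f x + linext g x.
Proof.
rewrite /linext scaler_sumr -big_split; apply: eq_bigr => w _ /=.
by rewrite scalerDr !scalerA mulrC.
Qed.

Lemma eq_linext f g : f =1 g -> linext f =1 linext g.
Proof. by move=> fg x; apply: eq_bigr => w _; rewrite fg. Qed.

End LinearExtension.

Lemma malg_ext (k : fieldType) (W : choiceType) (U : lmodType k)
    (f g : {malg k[W]} -> U) :
    linear f -> linear g -> (forall w, f << w >> = g << w >>) -> f =1 g.
Proof.
move=> f_lin g_lin fg x.
pose F : {linear {malg k[W]} -> U} :=
  HB.pack f (GRing.isLinear.Build k _ _ _ f f_lin).
pose G : {linear {malg k[W]} -> U} :=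
  HB.pack g (GRing.isLinear.Build k _ _ _ g g_lin).
rewrite -[f x]/(F x) -[g x]/(G x) (monalgE x) !linear_sum.
apply: eq_bigr => w _.
have -> : << x@_w *g w >> = x@_w *: << w >> :> {malg k[W]}.
  by apply/malgP => v; rewrite mcoeffZ !mcoeffU mulr_natr.
by rewrite !linearZ; congr (_ *: _); apply: fg.
Qed.

Section BilinearExtension.
Variables (k : fieldType) (V W : choiceType) (U : lmodType k).

Definition bilinext (f : V -> W -> U) (x : {malg k[V]}) (y : {malg k[W]}) : U :=
  linext (fun v => linext (f v) y) x.

Lemma bilinext_is_bilinear f : bilinear_for *:%R *:%R (bilinext f).
Proof.
split=> [y c x x' | x c y y']; first exact: linearP.
rewrite -[RHS]linext_lin.
by apply: eq_linext => v; rewrite linearP.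
Qed.

HB.instance Definition _ f :=
  bilinear_isBilinear.Build k {malg k[V]} {malg k[W]} U *:%R *:%R (bilinext f)
    (bilinext_is_bilinear f).

Lemma bilinextU f v w : bilinext f << v >> << w >> = f v w.
Proof. by rewrite /bilinext !linextU. Qed.

End BilinearExtension.

(* The tensor product of the spaces with bases V and W is realized as the     *)
(* space with basis V * W.                                                    *)
Section Tensor.
Variables (k : fieldType) (V W : choiceType).

Definition tensor : {malg k[V]} -> {malg k[W]} -> {malg k[(V * W)%type]} :=
  bilinext (fun v w => << (v, w) >>).

HB.instance Definition _ := Bilinear.on tensor.

(* tlift F t is the Sweedler sum of the F t_(1) t_(2), for F bilinear. *)
Definition tlift (U : lmodType k) (F : {malg k[V]} -> {malg k[W]} -> U) :
    {malg k[(V * W)%type]} -> U :=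
  linext (fun p => F << p.1 >> << p.2 >>).

HB.instance Definition _ U F := GRing.Linear.on (@tlift U F).

End Tensor.

Notation "x \ox y" := (tensor x y) (at level 40, left associativity) : ring_scope.

Section InfinitesimalHopf.
Variables (k : fieldType) (W : choiceType).
Local Notation H := {malg k[W]}.
Variables (mul : {bilinear H -> H -> H}) (delta : {linear H -> {malg k[(W * W)%type]}}).

Definition coassociative : Prop := forall w,
  tlift (fun x y => tlift (fun x1 x2 => x1 \ox x2 \ox y) (delta x)) (delta w) =
  tlift (fun x y => tlift (fun y1 y2 => x \ox y1 \ox y2) (delta y)) (delta w).

Definition infinitesimal_compatible : Prop := forall w v,
  delta (mul w v) = tlift (fun v1 v2 => mul w v1 \ox v2) (delta v)
                  + tlift (fun w1 w2 => w1 \ox mul w2 v) (delta w).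

Definition is_antipode (S : {linear H -> H}) : Prop := forall w,
  tlift (fun w1 w2 => mul (S w1) w2) (delta w) + S w + w = 0 /\
  tlift (fun w1 w2 => mul w1 (S w2)) (delta w) + w + S w = 0.

Record infinitesimal_hopf : Prop := InfinitesimalHopf {
  ih_mulA : associative mul;
  ih_coassoc : coassociative;
  ih_compatible : infinitesimal_compatible;
  ih_antipode : exists S : {linear H -> H}, is_antipode S
}.

End InfinitesimalHopf.

(* The compositions of n, as sequences of positive integers. *)
Fixpoint compositions (n : nat) : seq (seq nat) :=
  if n is n'.+1 then
    [seq 1%N :: c | c <- compositions n'] ++
    pmap (fun c => if c is i :: J then Some (i.+1 :: J) else None)
      (compositions n')
  else [:: [::]].

Lemma mem_compositions n c :
  (c \in compositions n) = (all (leq 1) c && (sumn c == n)).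
Proof.
elim: n c => [|n IHn] c /=.
  by rewrite inE; case: c => [|[|i] c] //=; rewrite addSn andbF.
rewrite mem_cat; case: c => [|i c] /=.
  rewrite mem_pmap; apply/negbTE; rewrite negb_or; apply/andP; split.
    by apply/mapP => -[].
  by apply/mapP => -[[]].
case: i => [|[|i]] /=.
- rewrite mem_pmap; apply/negbTE; rewrite negb_or; apply/andP; split.
    by apply/mapP => -[].
  by apply/mapP => -[[]].
- rewrite mem_map => [|? ? [] //]; rewrite IHn add1n eqSS.
  case: (boolP (_ && _)) => //= nc; rewrite mem_pmap; apply/mapP => -[[] //= i J].
  by rewrite IHn /= => /andP[/andP[i_gt0 _] _] [E]; rewrite -E in i_gt0.
have /negbTE-> /= : i.+2 :: c \notin [seq 1%N :: c0 | c0 <- compositions n].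
  by apply/mapP => -[].
rewrite mem_pmap; apply/mapP/idP => [[[] //= j J]|H].
  by rewrite IHn /= => /andP[/andP[_ aJ] sJ] [-> ->]; rewrite aJ addSn eqSS.
by exists (i.+1 :: c) => //; rewrite IHn /=.
Qed.

Lemma size_composition n c : c \in compositions n -> (size c <= n)%N.
Proof.
rewrite mem_compositions => /andP[+ /eqP <-].
elim: c => //= j c IHc /andP[j_gt0 /IHc le_c].
by rewrite -add1n leq_add.
Qed.

Lemma uniq_compositions n : uniq (compositions n).
Proof.
elim: n => //= n IHn; rewrite cat_uniq map_inj_uniq ?IHn => [/=|? ? [] //].
apply/andP; split.
  apply/hasPn => c; rewrite mem_pmap => /mapP[[] //= i J].
  rewrite mem_compositions /= => /andP[/andP[i_gt0 _] _] [->].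
  by apply/mapP => -[K _ [E]]; rewrite E in i_gt0.
apply: (@pmap_uniq _ _ _ (fun c => if c is i.+1 :: J then i :: J else [::])) => //.
by case=> [|i J].
Qed.

Section QuasiShuffle.
Variables (k : fieldType) (A : countType).
Local Notation kA := {malg k[A]}.
Local Notation word := {fmonom A}.
Local Notation kW := {malg k[{fmonom A}]}.
(* The ring product on kW is the concatenation product. *)

Definition letter : kA -> kW := linext (fun a => << fmu a >>).

HB.instance Definition _ := GRing.Linear.on letter.

Section Diamond.
Variable dia : {bilinear kA -> kA -> kA}.

Definition diamond_word (w v : word) : kW :=
  match w : seq A, v : seq A with
  | [::], _ => << v >>
  | _, [::] => << w >>
  | x :: w', b :: v' =>
      << FMonom (belast x w') >> * letter (dia << last x w' >> << b >>)
        * << FMonom v' >>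
  end.

Definition diamond : kW -> kW -> kW := bilinext diamond_word.

HB.instance Definition _ := Bilinear.on diamond.

(* The value on [::] is never used, as the parts of a composition are positive. *)
Definition block (s : seq A) : kA :=
  if s is a :: s' then foldl (fun x b => dia x << b >>) << a >> s' else 0.

Definition comp_act (c : seq nat) (w : word) : kW :=
  \prod_(s <- reshape c w) letter (block s).

Definition Sigma : kW -> kW :=
  linext (fun w : word => \sum_(c <- compositions (size w)) comp_act c w).

Definition Sigma_inv : kW -> kW :=
  linext (fun w : word =>
    \sum_(c <- compositions (size w)) (-1) ^+ (size w - size c) *: comp_act c w).

HB.instance Definition _ := GRing.Linear.on Sigma.
HB.instance Definition _ := GRing.Linear.on Sigma_inv.

End Diamond.

Definition deconcat_word (w : word) : {malg k[(word * word)%type]} :=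
  \sum_(i < (size w).+1) << (FMonom (take i w), FMonom (drop i w)) >>.

Definition rdeconcat_word (w : word) : {malg k[(word * word)%type]} :=
  if w == mone :> word then 0
  else deconcat_word w - << w >> \ox << mone >> - << mone >> \ox << w >>.

Definition rdeconcat : kW -> {malg k[(word * word)%type]} := linext rdeconcat_word.

HB.instance Definition _ := GRing.Linear.on rdeconcat.

End QuasiShuffle.

Arguments rdeconcat k A x : clear implicits.

(* The algebra behind the inversion of Sigma, over abstract vector spaces: X is *)
(* spanned by letters bx, V by words bw, L x u is the word u with x prepended,  *)
(* D x u is x diamond u, and S e weights each contraction of two letters by e.  *)
Section AbstractInverse.
Variables (k : fieldType) (A : Type) (X V : lmodType k).
Variables (bx : A -> X) (bw : seq A -> V) (dia : X -> X -> X).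
Variables (L D : X -> V -> V) (S : k -> V -> V).
Hypothesis diaA : associative dia.
Hypothesis LPl : forall c x y u, L (c *: x + y) u = c *: L x u + L y u.
Hypothesis LPr : forall c x u v, L x (c *: u + v) = c *: L x u + L x v.
Hypothesis DPl : forall c x y u, D (c *: x + y) u = c *: D x u + D y u.
Hypothesis DPr : forall c x u v, D x (c *: u + v) = c *: D x u + D x v.
Hypothesis SP : forall e c u v, S e (c *: u + v) = c *: S e u + S e v.
Hypothesis extX : forall f g : X -> V, linear f -> linear g ->
  (forall a, f (bx a) = g (bx a)) -> f =1 g.
Hypothesis extV : forall f g : V -> V, linear f -> linear g ->
  (forall s, f (bw s) = g (bw s)) -> f =1 g.
Hypothesis bwE : forall a s, bw (a :: s) = L (bx a) (bw s).
Hypothesis DL : forall y x u, D y (L x u) = L (dia y x) u.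
Hypothesis extS : forall f g : V -> V, linear f -> linear g ->
    (forall x u, f (L x u) = g (L x u)) ->
  forall e a s, f (S e (bw (a :: s))) = g (S e (bw (a :: s))).
Hypothesis S0 : forall e, S e (bw [::]) = bw [::].
Hypothesis S1 : forall e x, S e (L x (bw [::])) = L x (bw [::]).
Hypothesis S2 : forall e a b s, S e (bw [:: a, b & s]) =
  L (bx a) (S e (bw (b :: s))) + e *: D (bx a) (S e (bw (b :: s))).

Local Lemma linDZ (e c : k) (x y x' y' : V) :
  c *: x + y + e *: (c *: x' + y') = c *: (x + e *: x') + (y + e *: y').
Proof. by rewrite !scalerDr !scalerA (mulrC e) addrACA. Qed.

Local Lemma S_LL e y x u :
  S e (L y (L x u)) = L y (S e (L x u)) + e *: D y (S e (L x u)).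
Proof.
apply: (extX (f := fun y => S e (L y (L x u)))
  (g := fun y => L y (S e (L x u)) + e *: D y (S e (L x u)))) y
  => [c y y'|c y y'|b]; [by rewrite LPl SP | by rewrite LPl DPl linDZ |].
apply: (extX (f := fun x => S e (L (bx b) (L x u)))
  (g := fun x => L (bx b) (S e (L x u)) + e *: D (bx b) (S e (L x u)))) x
  => [c x x'|c x x'|a].
- by rewrite LPl LPr SP.
- by rewrite LPl SP LPr DPr linDZ.
apply: (extV (f := fun u => S e (L (bx b) (L (bx a) u)))
  (g := fun u => L (bx b) (S e (L (bx a) u)) + e *: D (bx b) (S e (L (bx a) u)))) u
  => [c u u'|c u u'|s].
- by rewrite !LPr SP.
- by rewrite LPr SP LPr DPr linDZ.
by rewrite -!bwE S2.
Qed.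

Local Lemma DA_S e y x a s :
  D y (D x (S e (bw (a :: s)))) = D (dia y x) (S e (bw (a :: s))).
Proof.
apply: (extS (f := fun v => D y (D x v)) (g := fun v => D (dia y x) v))
  => [c u u'|c u u'|z u]; [by rewrite !DPr | by rewrite DPr |].
by rewrite !DL diaA.
Qed.

Local Lemma S_DL e y x u : S e (D y (L x u)) = D y (S e (L x u)).
Proof.
apply: (extV (f := fun u => S e (D y (L x u))) (g := fun u => D y (S e (L x u)))) u
  => [c u u'|c u u'|[|a s]].
- by rewrite LPr DPr SP.
- by rewrite LPr SP DPr.
- by rewrite DL !S1 DL.
rewrite DL bwE !S_LL -bwE -DA_S -DL addrC [in RHS]addrC DPr.
by [].
Qed.

Local Lemma section_inverse e u : S (- e) (S e u) = u.
Proof.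
apply: (extV (f := fun u => S (- e) (S e u)) (g := id)) u => [c u u'|c u u'|s] //.
  by rewrite !SP.
elim: s => [|a [|b s] IHs]; first by rewrite !S0.
  by rewrite bwE !S1.
rewrite S2 [RHS]bwE -[in RHS]IHs.
apply: (extS (f := fun v => S (- e) (L (bx a) v + e *: D (bx a) v))
             (g := fun v => L (bx a) (S (- e) v))) => [c x y|c x y|x v].
- by rewrite LPr DPr linDZ SP.
- by rewrite SP LPr.
rewrite addrC SP S_DL S_LL.
by rewrite addrC -addrA scaleNr addNr addr0.
Qed.

End AbstractInverse.

(* Sigma_inv is the two-sided inverse of Sigma: SigmaK and Sigma_invK below.   *)
Section SigmaInverse.
Variables (k : fieldType) (A : countType).
Local Notation kA := {malg k[A]}.
Local Notation word := {fmonom A}.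
Local Notation kW := {malg k[{fmonom A}]}.
Variable dia : {bilinear kA -> kA -> kA}.
Hypothesis diaA : associative dia.
Local Notation dm := (diamond dia).
Local Notation ltr := (@letter k A).

Local Definition Sg (e : k) : kW -> kW := linext (fun w : word =>
  \sum_(c <- compositions (size w)) e ^+ (size w - size c) *: comp_act dia c w).

Local Lemma mulUU (v w : word) : << v >> * << w >> = << mmul v w >> :> kW.
Proof. by rewrite malgM_def fgmulUU mulr1. Qed.

Local Lemma U1 : << FMonom [::] >> = 1 :> kW.
Proof. by rewrite -fmoneE. Qed.

Local Lemma ltrU a : ltr << a >> = << FMonom [:: a] >>.
Proof. by rewrite /letter linextU fmuE. Qed.

Local Lemma consE a (s : seq A) : << FMonom (a :: s) >> = ltr << a >> * << FMonom s >> :> kW.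
Proof. by rewrite ltrU mulUU /mmul /= fmmulE. Qed.

Local Lemma mulPl c (x y z : kW) : (c *: x + y) * z = c *: (x * z) + y * z.
Proof. by rewrite mulrDl scalerAl. Qed.

Local Lemma ZU c (w : word) : c *: << w >> = << c *g w >> :> kW.
Proof. by apply/malgP => v; rewrite mcoeffZ !mcoeffU mulr_natr. Qed.

Local Lemma mulUE (w : word) (y : kW) :
  << w >> * y = linext (fun v => << mmul w v >>) y.
Proof.
rewrite malgM_def fgmulUg; apply: eq_bigr => v _.
by rewrite ZU mul1r.
Qed.

Local Lemma mulZr c (x y : kW) : x * (c *: y) = c *: (x * y).
Proof.
apply: (malg_ext (f := fun x => x * (c *: y)) (g := fun x => c *: (x * y))) x.
- by move=> d x x'; rewrite mulPl.
- by move=> d x x'; rewrite mulPl scalerDr !scalerA mulrC.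
by move=> w; rewrite !mulUE linearZ.
Qed.

Local Lemma mulPr c (x y z : kW) : z * (c *: x + y) = c *: (z * x) + z * y.
Proof. by rewrite mulrDr mulZr. Qed.

Local Lemma ltrP c (x y : kA) : ltr (c *: x + y) = c *: ltr x + ltr y.
Proof. exact: linearP. Qed.

Local Lemma SgP e c (x y : kW) : Sg e (c *: x + y) = c *: Sg e x + Sg e y.
Proof. exact: linearP. Qed.

Local Lemma dmPl c (x y z : kW) : dm (c *: x + y) z = c *: dm x z + dm y z.
Proof. exact: linearPl. Qed.

Local Lemma dmPr c (x y z : kW) : dm z (c *: x + y) = c *: dm z x + dm z y.
Proof. exact: linearPr. Qed.

Local Lemma dmDr (x y z : kW) : dm z (x + y) = dm z x + dm z y.
Proof. by rewrite -[in LHS](scale1r x) dmPr scale1r. Qed.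

Local Lemma dmZr c (x z : kW) : dm z (c *: x) = c *: dm z x.
Proof. exact: linearZr. Qed.

Local Lemma dm_sumr (I : Type) (r : seq I) (F : I -> kW) z :
  dm z (\sum_(i <- r) F i) = \sum_(i <- r) dm z (F i).
Proof. exact: (big_morph (dm z) (fun x y => dmDr x y z) (linear0r _ z)). Qed.

Local Lemma diaPl c (x y z : kA) : dia (c *: x + y) z = c *: dia x z + dia y z.
Proof. exact: linearPl. Qed.

Local Lemma diaPr c (x y z : kA) : dia z (c *: x + y) = c *: dia z x + dia z y.
Proof. exact: linearPr. Qed.

Local Lemma dmltr y x u : dm (ltr y) (ltr x * u) = ltr (dia y x) * u.
Proof.
apply: (malg_ext (f := fun y => dm (ltr y) (ltr x * u))
                 (g := fun y => ltr (dia y x) * u)) y => [c y y'|c y y'|b].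
- by rewrite ltrP dmPl.
- by rewrite diaPl ltrP mulPl.
apply: (malg_ext (f := fun x => dm (ltr << b >>) (ltr x * u))
                 (g := fun x => ltr (dia << b >> x) * u)) x => [c x x'|c x x'|a].
- by rewrite ltrP mulPl dmPr.
- by rewrite diaPr ltrP mulPl.
apply: (malg_ext (f := fun u => dm (ltr << b >>) (ltr << a >> * u))
                 (g := fun u => ltr (dia << b >> << a >>) * u)) u
    => [c u u'|c u u'|[s]].
- by rewrite mulPr dmPr.
- by rewrite mulPr.
by rewrite -consE ltrU /diamond bilinextU /diamond_word /= U1 mul1r.
Qed.

Local Lemma SgU e (s : seq A) : Sg e << FMonom s >> =
  \sum_(c <- compositions (size s)) e ^+ (size s - size c)
    *: comp_act dia c (FMonom s).
Proof. by rewrite /Sg linextU. Qed.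

Local Lemma Sg1 e : Sg e 1 = 1.
Proof.
by rewrite -U1 SgU /= big_seq1 subnn expr0 scale1r /comp_act /= big_nil U1.
Qed.

Local Lemma Sg_ext (f g : kW -> kW) : linear f -> linear g ->
    (forall x u, f (ltr x * u) = g (ltr x * u)) ->
  forall e a s, f (Sg e << FMonom (a :: s) >>) = g (Sg e << FMonom (a :: s) >>).
Proof.
move=> f_lin g_lin fg e a s.
pose F : {linear kW -> kW} := HB.pack f (GRing.isLinear.Build k _ _ _ f f_lin).
pose G : {linear kW -> kW} := HB.pack g (GRing.isLinear.Build k _ _ _ g g_lin).
rewrite -[LHS]/(F _) -[RHS]/(G _) SgU !linear_sum !(big_seq_cond predT).
apply: eq_bigr => -[|i c]; rewrite andbT mem_compositions // => _.
rewrite !linearZ; congr (_ *: _).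
by rewrite /comp_act /= big_cons; apply: fg.
Qed.

Local Lemma block_cons a b (s : seq A) :
  block dia [:: a, b & s] = dia << a >> (block dia (b :: s)).
Proof.
rewrite /block /=; elim: s << b >> => //= d s IHs x.
by rewrite -IHs diaA.
Qed.

Local Lemma dm_act a b s c : c \in compositions (size (b :: s)) ->
  dm (ltr << a >>) (comp_act dia c (FMonom (b :: s))) =
  if c is i :: c' then comp_act dia (i.+1 :: c') (FMonom [:: a, b & s]) else 0.
Proof.
rewrite mem_compositions; case: c => [|[|i] c] //= _.
by rewrite /comp_act /= !big_cons dmltr -block_cons.
Qed.

Local Lemma big_pmap_incr (F : seq nat -> kW) (r : seq (seq nat)) :
  \sum_(c <- pmap (fun c => if c is i :: c' then Some (i.+1 :: c') else None) r)
    F c = \sum_(c <- r) if c is i :: c' then F (i.+1 :: c') else 0.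
Proof.
elim: r => [|[|i c] r IH] /=; first by rewrite !big_nil.
  by rewrite big_cons add0r.
by rewrite !big_cons IH.
Qed.

Local Lemma Sg_cons2 e a b s : Sg e << FMonom [:: a, b & s] >> =
  ltr << a >> * Sg e << FMonom (b :: s) >> +
  e *: dm (ltr << a >>) (Sg e << FMonom (b :: s) >>).
Proof.
rewrite !SgU [size (_ :: _ :: _)]/=.
have -> n : compositions n.+2 = [seq 1%N :: c | c <- compositions n.+1] ++
  pmap (fun c => if c is i :: c' then Some (i.+1 :: c') else None)
    (compositions n.+1) by [].
rewrite big_cat big_map big_pmap_incr; congr (_ + _).
  rewrite mulr_sumr; apply: eq_bigr => c _.
  by rewrite mulZr subSS /comp_act /= big_cons ?take0 ?drop0.
rewrite dm_sumr scaler_sumr big_seq [RHS]big_seq.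
apply: eq_bigr => -[|i c] cP; first by exfalso; move: cP; rewrite mem_compositions.
rewrite dmZr (dm_act a cP) scalerA -exprS; congr (_ ^+ _ *: _).
have /= le_c := size_composition cP.
by rewrite subSS /= subSn.
Qed.

Local Lemma Sg_ltr e x : Sg e (ltr x) = ltr x.
Proof.
apply: (malg_ext (f := fun x => Sg e (ltr x)) (g := ltr)) x => [c x y|c x y|a].
- by rewrite ltrP SgP.
- exact: ltrP.
rewrite ltrU SgU /= big_seq1 subnn expr0 scale1r /comp_act /= big_seq1.
by rewrite /= ltrU.
Qed.

Local Lemma SgK e u : Sg (- e) (Sg e u) = u.
Proof.
apply: (@section_inverse k A kA kW (fun a => << a >>) (fun s => << FMonom s >>)
  dia (fun x u => ltr x * u) (fun x u => dm (ltr x) u) Sg) => //.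
- by move=> c x y v; rewrite ltrP mulPl.
- by move=> c x v v'; rewrite mulPr.
- by move=> c x y v; rewrite ltrP dmPl.
- by move=> c x v v'; rewrite dmPr.
- exact: SgP.
- exact: malg_ext.
- by move=> f g f_lin g_lin fg; apply: malg_ext => // -[s]; apply: fg.
- exact: consE.
- exact: dmltr.
- exact: Sg_ext.
- by move=> e'; rewrite U1 Sg1.
- by move=> e' x; rewrite U1 mulr1 Sg_ltr.
- exact: Sg_cons2.
Qed.

Local Lemma Sigma_Sg : Sigma dia =1 Sg 1.
Proof.
move=> x; apply: eq_linext => w; apply: eq_bigr => c _.
by rewrite expr1n scale1r.
Qed.

Lemma SigmaK : cancel (Sigma dia) (Sigma_inv dia).
Proof. by move=> x; rewrite Sigma_Sg; exact: SgK. Qed.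

Lemma Sigma_invK : cancel (Sigma_inv dia) (Sigma dia).
Proof. by move=> x; rewrite Sigma_Sg -{1}[1]opprK; exact: SgK. Qed.

End SigmaInverse.

(* Main.v *)
Require Import Defs.
From HB Require Import structures.
From mathcomp Require Import all_boot all_order all_algebra.
From mathcomp Require Import finmap.
From mathcomp.multinomials Require Import monalg.

Set Implicit Arguments.
Unset Strict Implicit.
Unset Printing Implicit Defensive.

Import GRing.Theory.

Local Open Scope ring_scope.

(** Write x <> y for the diamond product, x (x) y for tensors, and a.u for the
    word u with the letter a put in front, extended to a bilinear operation
    (lcons).  Every word is built from the empty word by this
    operation, and each structure map of the theorem has a simple recursion
    along it, valid when u lies in the augmentation ideal, i.e. has no component
    on the empty word (for the empty word, a.1 = a is a letter, which behaves
    differently):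
      (a.u) <> v     = a.(u <> v)                           (dm_lcons),
      delta (a.u)    = sum (a.u_1) (x) u_2 + a (x) u        (delta_lcons),
      T (a.u)        = a.(T u) - a <> T u                   (Sigma_inv_cons),
    where T is the inverse of Sigma; the last one splits the compositions
    according to whether the first letter is a block by itself or is contracted
    with its successor.  A letter multiplies by contraction with the next
    letter: a <> (b.v) = (a <> b).v (dm_ltr_lcons).

    Associativity of the product and its compatibility with the coproduct follow
    by induction on the left factor; the case of a single letter is where
    associativity on letters enters.  Coassociativity says that a word is cut
    into three nonempty pieces in the same ways, whichever cut is made first.

    For the antipode - T it suffices that T w + sum w_1 <> T w_2 = w and
    T w + sum (T w_1) <> w_2 = w.  Both follow by induction on w = a.u.  On the
    right, the term a <> T u coming from the cut after a cancels the negative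
    term of T (a.u), leaving a.(T u + sum u_1 <> T u_2) = a.u.  On the left, put
    phi u = a.u - a <> u; by associativity phi passes through right
    multiplications, so the sum is phi (T u + sum (T u_1) <> u_2) + a <> u
    = phi u + a <> u = a.u. *)

(** * Linear maps and double sums *)

Lemma linear_add (k : pzRingType) (U U' : lmodType k) (f g : U -> U') :
  linear f -> linear g -> linear (fun x => f x + g x).
Proof.
by move=> f_lin g_lin c x y; rewrite f_lin g_lin scalerDr addrACA.
Qed.

Lemma linear_sub (k : pzRingType) (U U' : lmodType k) (f g : U -> U') :
  linear f -> linear g -> linear (fun x => f x - g x).
Proof.
by move=> f_lin g_lin c x y; rewrite f_lin g_lin scalerBr opprD addrACA.
Qed.

Lemma lin_add (k : pzRingType) (U U' : lmodType k) (f : U -> U') :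
  linear f -> {morph f : x y / x + y}.
Proof. by move=> f_lin x y; rewrite -[x in LHS]scale1r f_lin scale1r. Qed.

Lemma subDDK (V : zmodType) (x y z : V) : x - y + (z + y) = x + z.
Proof. by rewrite addrACA addNr addr0. Qed.

(** Both sides enumerate the pairs of cuts j < i = j + l of a word of length n:
    the left side chooses the last cut first, the right side the first one. *)
Lemma big_triangle (V : nmodType) (F : nat -> nat -> V) n :
  \sum_(1 <= i < n) \sum_(1 <= j < i) F i j =
  \sum_(1 <= j < n) \sum_(1 <= l < n - j) F (j + l)%N j.
Proof.
transitivity (\sum_(1 <= i < n) \sum_(1 <= j < n | (j < i)%N) F i j).
  apply: eq_big_nat => i /andP[_ lt_in].
  by rewrite (big_nat_widen _ _ n) ?(ltnW lt_in).
rewrite (exchange_big_dep_nat xpredT) //=; apply: eq_big_nat => j /andP[j0 ltjn].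
transitivity (\sum_(1 + j <= i < n) F i j).
  by rewrite [RHS](big_nat_widenl _ 1).
by rewrite big_addn; apply: eq_bigr => l _; rewrite addnC.
Qed.

(** * Sweedler sums *)

(** Locked, like the operations on words below, so that rewriting treats it as a
    symbol instead of unfolding it into finite sums. *)
HB.lock Definition sweedler (k : fieldType) (V W : choiceType) (U : lmodType k)
    (F : {malg k[V]} -> {malg k[W]} -> U) (t : {malg k[(V * W)%type]}) : U :=
  tlift F t.

Section Tlift.
Variables (k : fieldType) (V W : choiceType).
Local Notation T := {malg k[(V * W)%type]}.

Lemma tensorU (v : V) (w : W) : << v >> \ox << w >> = << (v, w) >> :> T.
Proof. exact: bilinextU. Qed.

Lemma tensorPl c x y (z : {malg k[W]}) :
  (c *: x + y) \ox z = c *: (x \ox z) + y \ox z :> T.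
Proof. exact: linearPl. Qed.

Lemma tensorPr c x y (z : {malg k[V]}) :
  z \ox (c *: x + y) = c *: (z \ox x) + z \ox y :> T.
Proof. exact: linearPr. Qed.

Lemma sweedlerU (U : lmodType k) (F : {malg k[V]} -> {malg k[W]} -> U) v w :
  sweedler F << (v, w) >> = F << v >> << w >>.
Proof. by rewrite unlock /tlift linextU. Qed.

Lemma sweedler_lin (U : lmodType k) c (F G H : {malg k[V]} -> {malg k[W]} -> U) t :
  (forall v w, F << v >> << w >> = c *: G << v >> << w >> + H << v >> << w >>) ->
  sweedler F t = c *: sweedler G t + sweedler H t.
Proof. by move=> FGH; rewrite unlock -[RHS]linext_lin; apply: eq_linext => p. Qed.

Lemma sweedler_comp (U U' : lmodType k) (F : {malg k[V]} -> {malg k[W]} -> U)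
    (f : U -> U') t :
  linear f -> f (sweedler F t) = sweedler (fun x y => f (F x y)) t.
Proof.
move=> f_lin.
pose g : {linear U -> U'} := HB.pack f (GRing.isLinear.Build k _ _ _ f f_lin).
rewrite unlock -[LHS]/(g _) linear_sum; apply: eq_bigr => p _.
by rewrite linearZ.
Qed.

Lemma sweedlerP (U : lmodType k) (F : {malg k[V]} -> {malg k[W]} -> U) c x y :
  sweedler F (c *: x + y) = c *: sweedler F x + sweedler F y.
Proof. by rewrite unlock linearP. Qed.

Lemma sweedler0 (U : lmodType k) (F : {malg k[V]} -> {malg k[W]} -> U) :
  sweedler F 0 = 0.
Proof. by rewrite unlock linear0. Qed.

Lemma sweedlerD (U : lmodType k) (F : {malg k[V]} -> {malg k[W]} -> U) x y :
  sweedler F (x + y) = sweedler F x + sweedler F y.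
Proof. by rewrite unlock linearD. Qed.

Lemma sweedler_sum (U : lmodType k) (F : {malg k[V]} -> {malg k[W]} -> U)
    (I : Type) (r : seq I) P G :
  sweedler F (\sum_(i <- r | P i) G i) = \sum_(i <- r | P i) sweedler F (G i).
Proof. by rewrite unlock linear_sum. Qed.

Lemma eq_sweedler (U : lmodType k) (F G : {malg k[V]} -> {malg k[W]} -> U) :
  F =2 G -> sweedler F =1 sweedler G.
Proof. by move=> FG t; rewrite unlock; apply: eq_linext => p. Qed.

Lemma sweedlerN (U : lmodType k) (F : {malg k[V]} -> {malg k[W]} -> U) t :
  sweedler (fun x y => - F x y) t = - sweedler F t.
Proof.
by rewrite [RHS]sweedler_comp // => c x y; rewrite opprD scalerN.
Qed.

Lemma sweedler_tensor t : sweedler (fun x y => x \ox y) t = t :> T.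
Proof.
apply: (malg_ext (f := sweedler (fun x y => x \ox y))
  (g := id)) t => [c x y|c x y|[v w]] //.
  exact: sweedlerP.
by rewrite sweedlerU tensorU.
Qed.

End Tlift.

(** * Words built by prepending letters *)

HB.lock Definition lcons (k : fieldType) (A : countType)
    (x : {malg k[A]}) (u : {malg k[{fmonom A}]}) : {malg k[{fmonom A}]} :=
  letter x * u.

HB.lock Definition dmul (k : fieldType) (A : countType)
    (dia : {bilinear {malg k[A]} -> {malg k[A]} -> {malg k[A]}}) :=
  diamond dia.

HB.lock Definition cuts (k : fieldType) (A : countType) (x : {malg k[{fmonom A}]}) :=
  rdeconcat k A x.

Section Diamond.
Variables (k : fieldType) (A : countType).
Local Notation kA := {malg k[A]}.
Local Notation word := {fmonom A}.
Local Notation kW := {malg k[{fmonom A}]}.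
Variable dia : {bilinear kA -> kA -> kA}.
Local Notation dm := (dmul dia).
Local Notation wd s := (<< FMonom s >> : kW).
Local Notation lcons := (@lcons k A).
Local Notation ltr a := (lcons a (wd [::])).
Local Notation delta := (@cuts k A).

Lemma deltaP c x y : delta (c *: x + y) = c *: delta x + delta y.
Proof. by rewrite unlock linearP. Qed.

Lemma lconsPl c x y u : lcons (c *: x + y) u = c *: lcons x u + lcons y u.
Proof. by rewrite unlock Defs.ltrP Defs.mulPl. Qed.

Lemma lconsPr c x u v : lcons x (c *: u + v) = c *: lcons x u + lcons x v.
Proof. by rewrite unlock Defs.mulPr. Qed.

Lemma lconsU a (s : seq A) : lcons << a >> (wd s) = wd (a :: s).
Proof. by rewrite unlock Defs.consE. Qed.

Lemma ltrE x : letter x = ltr x.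
Proof. by rewrite unlock Defs.U1 mulr1. Qed.

Lemma dmPl c x y z : dm (c *: x + y) z = c *: dm x z + dm y z.
Proof. by rewrite unlock Defs.dmPl. Qed.

Lemma dmPr c x y z : dm z (c *: x + y) = c *: dm z x + dm z y.
Proof. by rewrite unlock Defs.dmPr. Qed.

Lemma dmU v w : dm << v >> << w >> = diamond_word dia v w.
Proof. by rewrite unlock /diamond bilinextU. Qed.

(** The augmentation ideal: the span of the nonempty words. *)
Definition aug (x : kW) : Prop := x@_(mone : word) = 0.

Lemma augU a (s : seq A) : aug (wd (a :: s)).
Proof. by rewrite /aug mcoeffU1 -[mone]/(fmone A) fmoneE. Qed.

(** The projection z |-> z - z_1 1 is linear, kills the empty word and fixes the
    augmentation ideal, so that composing with it reduces the claim to
    extensionality on all words. *)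
Lemma aug_ext (U : lmodType k) (f g : kW -> U) : linear f -> linear g ->
    (forall a s, f (wd (a :: s)) = g (wd (a :: s))) ->
  forall x, aug x -> f x = g x.
Proof.
move=> f_lin g_lin fg x x0.
pose p (z : kW) : kW := z - z@_(mone : word) *: 1.
have p_lin : linear p.
  move=> c y z; rewrite /p mcoeffD mcoeffZ scalerDl scalerBr scalerA.
  by rewrite opprD addrACA.
have px : p x = x by rewrite /p x0 scale0r subr0.
rewrite -px; move: x {x0 px}; apply: malg_ext.
- by move=> c y z; rewrite p_lin f_lin.
- by move=> c y z; rewrite p_lin g_lin.
case=> [[|a s]]; last first.
  by rewrite /p augU scale0r subr0.
have -> : p << FMonom [::] >> = 0.
  by rewrite /p Defs.U1 mcoeff1 eqxx scale1r subrr.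
pose F : {linear kW -> U} := HB.pack f (GRing.isLinear.Build k _ _ _ f f_lin).
pose G : {linear kW -> U} := HB.pack g (GRing.isLinear.Build k _ _ _ g g_lin).
by rewrite -[LHS]/(F 0) -[RHS]/(G 0) !linear0.
Qed.

Lemma aug_lcons x u : aug (lcons x u).
Proof.
have ux y v : y@_(mone : word) = 0 -> (y * v : kW)@_(mone : word) = 0.
  by move=> y0; rewrite [LHS]rmorphM [X in X * _]y0 mul0r.
rewrite unlock; apply: ux.
apply: (malg_ext (U := k^o) (f := fun x => (letter x)@_(mone : word)) (g := fun=> 0)) x.
- by move=> c x y; rewrite Defs.ltrP mcoeffD mcoeffZ.
- by move=> c x y; rewrite scaler0 addr0.
by move=> a; rewrite Defs.ltrU augU.
Qed.

(** * Associativity of the diamond product *)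

Lemma dm1l x : dm (wd [::]) x = x.
Proof.
apply: (malg_ext (f := dm (wd [::])) (g := id)) x => [c x y|c x y|[s]] //.
  exact: dmPr.
by rewrite dmU.
Qed.

Lemma dm1r x : dm x (wd [::]) = x.
Proof.
apply: (malg_ext (f := fun x => dm x (wd [::]))
  (g := id)) x => [c x y|c x y|[[|a s]]] //.
- exact: dmPl.
- by rewrite dm1l.
- by rewrite dmU.
Qed.

Lemma dm_ltr_lcons y x u : dm (ltr y) (lcons x u) = lcons (dia y x) u.
Proof. by rewrite -ltrE !unlock Defs.dmltr. Qed.

Lemma dm_word_cons a b d (s t : seq A) :
  dm (wd [:: a, b & s]) (wd (d :: t)) = lcons << a >> (dm (wd (b :: s)) (wd (d :: t))).
Proof.
have mulA4 (x z u v : kW) : x * z * u * v = x * (z * u * v) by rewrite !mulrA.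
rewrite !dmU unlock /diamond_word /=.
rewrite (Defs.consE k a (belast b s)).
by apply: mulA4.
Qed.

(** A nonempty left factor is contracted with y through its last letter only,
    so its first letter can be taken out.  For x = 1 this fails: the letter a is
    then itself contracted. *)
Lemma dm_lcons a x y : aug x -> dm (lcons a x) y = lcons a (dm x y).
Proof.
move=> x0; apply: (aug_ext (f := fun x => dm (lcons a x) y)
                   (g := fun x => lcons a (dm x y))) x x0 => [c x z|c x z|b s].
- by rewrite lconsPr dmPl.
- by rewrite dmPl lconsPr.
apply: (malg_ext (f := fun y => dm (lcons a (wd (b :: s))) y)
   (g := fun y => lcons a (dm (wd (b :: s)) y))) y => [c y z|c y z|[[|d t]]].
- by rewrite dmPr.
- by rewrite dmPr lconsPr.
- by rewrite !dm1r.
apply: (malg_ext (f := fun a => dm (lcons a (wd (b :: s))) (wd (d :: t)))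
   (g := fun a => lcons a (dm (wd (b :: s)) (wd (d :: t))))) a
  => [c y z|c y z|a].
- by rewrite lconsPl dmPl.
- by rewrite lconsPl.
by rewrite lconsU dm_word_cons.
Qed.

(** This keeps the recursion dm_lcons applicable to iterated products. *)
Lemma aug_dm x y : aug x -> aug (dm x y).
Proof.
move=> x0; apply: (aug_ext (U := k^o) (f := fun x => (dm x y)@_(mone : word))
                   (g := fun x => 0)) x x0 => [c x z|c x z|b s].
- by rewrite dmPl mcoeffD mcoeffZ.
- by rewrite scaler0 addr0.
case: s => [|d s]; last first.
  by rewrite -lconsU dm_lcons; [apply: aug_lcons | apply: augU].
rewrite -lconsU.
apply: (malg_ext (U := k^o) (f := fun y => (dm (ltr << b >>) y)@_(mone : word))
  (g := fun y => 0)) y => [c y z|c y z|[[|d t]]].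
- by rewrite dmPr mcoeffD mcoeffZ.
- by rewrite scaler0 addr0.
- by rewrite dm1r; apply: aug_lcons.
by rewrite -lconsU dm_ltr_lcons; apply: aug_lcons.
Qed.

Hypothesis diaA : associative dia.

(** The base case of associativity, with a one-letter left factor.  If y has at
    least two letters, the two contractions happen at different ends of y and
    are independent; if y is a letter b, both products contract a, b and the
    first letter of z. *)
Lemma dm_ltrA a y z : dm (ltr a) (dm y z) = dm (dm (ltr a) y) z.
Proof.
apply: (malg_ext (f := fun y => dm (ltr a) (dm y z))
                 (g := fun y => dm (dm (ltr a) y) z)) y => [c x y|c x y|[[|b s]]].
- by rewrite dmPl dmPr.
- by rewrite dmPr dmPl.
- by rewrite dm1l dm1r.
rewrite -lconsU dm_ltr_lcons; case: s => [|d s]; last first.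
  have ds0 := augU d s.
  by rewrite (dm_lcons << b >> z ds0) dm_ltr_lcons (dm_lcons _ z ds0).
apply: (malg_ext (f := fun z => dm (ltr a) (dm (ltr << b >>) z))
                 (g := fun z => dm (ltr (dia a << b >>)) z)) z
  => [c x z|c x z|[[|d t]]].
- by rewrite !dmPr.
- by rewrite dmPr.
- by rewrite !dm1r dm_ltr_lcons.
by rewrite -lconsU !dm_ltr_lcons diaA.
Qed.

Lemma diamondA : associative dm.
Proof.
move=> x y z; apply: (malg_ext (f := fun x => dm x (dm y z))
                 (g := fun x => dm (dm x y) z)) x => [c x x'|c x x'|[s]].
- by rewrite dmPl.
- by rewrite !dmPl.
elim: s => [|a [|b s] IHs]; first by rewrite !dm1l.
  by rewrite -lconsU dm_ltrA.
have s0 := augU b s.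
by rewrite -lconsU !(dm_lcons _ _ s0) (dm_lcons _ _ (aug_dm _ s0)) IHs.
Qed.

(** * The reduced deconcatenation coproduct *)

Lemma deltaU (s : seq A) : delta (wd s) =
  \sum_(1 <= i < size s) << (FMonom (take i s), FMonom (drop i s)) >>.
Proof.
rewrite unlock /rdeconcat linextU /rdeconcat_word -[mone]/(fmone A) fmoneE.
case: s => [|a s]; first by rewrite eqxx big_geq.
case: eqP => [[]|_] //; rewrite /deconcat_word !tensorU -(big_mkord xpredT
  (fun i => << (FMonom (take i (a :: s)), FMonom (drop i (a :: s))) >>)).
rewrite big_nat_recl // big_add1 big_nat_recr //= take_size drop_size.
by rewrite addrA addrK addrAC subrr add0r.
Qed.

Lemma delta_ltr a : delta (ltr a) = 0.
Proof.
apply: (malg_ext (f := fun a => delta (ltr a)) (g := fun=> 0)) a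
  => [c x y|c x y|a].
- by rewrite lconsPl deltaP.
- by rewrite scaler0 addr0.
- by rewrite lconsU deltaU big_geq.
Qed.

(** A cut of a.y is either a cut of y or the one just after a. *)
Lemma delta_lcons a y : aug y -> delta (lcons a y) =
  sweedler (fun y1 y2 => lcons a y1 \ox y2) (delta y) + ltr a \ox y.
Proof.
move=> y0; apply: (aug_ext (f := fun y => delta (lcons a y))
  (g := fun y => sweedler (fun y1 y2 => lcons a y1 \ox y2) (delta y) + ltr a \ox y))
  y y0 => [c x z|c x z|b s].
- by rewrite lconsPr deltaP.
- by rewrite deltaP sweedlerP tensorPr scalerDr addrACA.
apply: (malg_ext (f := fun a => delta (lcons a (wd (b :: s))))
  (g := fun a => sweedler (fun y1 y2 => lcons a y1 \ox y2)
    (delta (wd (b :: s))) + ltr a \ox wd (b :: s))) a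
  => [c x z|c x z|a].
- by rewrite lconsPl deltaP.
- rewrite lconsPl tensorPl scalerDr addrACA; apply: (f_equal2 +%R); last by [].
  by apply: sweedler_lin => v w; rewrite lconsPl tensorPl.
rewrite lconsU !deltaU big_nat_recl // addrC lconsU tensorU.
congr (_ + _); rewrite sweedler_sum !big_add1; apply: eq_bigr => i _.
by rewrite /= sweedlerU lconsU tensorU.
Qed.

(** Both tensor factors of the reduced coproduct lie in the augmentation ideal,
    which is what makes dm_lcons applicable inside Sweedler sums. *)
Lemma eq_sweedler_delta (U : lmodType k) (F G : kW -> kW -> U) x :
    (forall a s b t, F (wd (a :: s)) (wd (b :: t)) = G (wd (a :: s)) (wd (b :: t))) ->
  sweedler F (delta x) = sweedler G (delta x).
Proof.
move=> FG; apply: (malg_ext (f := fun x => sweedler F (delta x))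
  (g := fun x => sweedler G (delta x))) x => [c x y|c x y|[s]];
  rewrite ?deltaP ?sweedlerP //.
rewrite deltaU !sweedler_sum.
apply: eq_big_nat => i /andP[i_gt0 lti]; rewrite /= !sweedlerU.
by case: i i_gt0 lti => // i _; case: s => // a s lti;
  rewrite (drop_nth a) //; apply: FG.
Qed.

Lemma sweedler_delta_lcons (U : lmodType k) (F : kW -> kW -> U) a b (s : seq A) :
  sweedler F (delta (wd [:: a, b & s])) =
  sweedler (fun x y => F (lcons << a >> x) y) (delta (wd (b :: s)))
    + F (ltr << a >>) (wd (b :: s)).
Proof.
rewrite -lconsU delta_lcons; last exact: augU.
rewrite sweedlerD lconsU tensorU sweedlerU; apply: (f_equal2 +%R); last by [].
rewrite sweedler_comp; last exact: sweedlerP.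
by apply: eq_sweedler_delta => c t d u; rewrite lconsU tensorU sweedlerU.
Qed.

Lemma delta0 : delta (wd [::]) = 0.
Proof. by rewrite deltaU big_geq. Qed.

Lemma sweedler_lcons a (x y : kW) :
  sweedler (fun u v => lcons a u \ox v) (x \ox y) = lcons a x \ox y.
Proof.
apply: (malg_ext (f := fun x => sweedler (fun u v => lcons a u \ox v) (x \ox y))
  (g := fun x => lcons a x \ox y)) x => [c x z|c x z|v].
- by rewrite tensorPl sweedlerP.
- by rewrite lconsPr tensorPl.
apply: (malg_ext (f := fun y => sweedler (fun u v => lcons a u \ox v) (<< v >> \ox y))
  (g := fun y => lcons a << v >> \ox y)) y => [c y z|c y z|w].
- by rewrite tensorPr sweedlerP.
- by rewrite tensorPr.
by rewrite tensorU sweedlerU.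
Qed.

Lemma delta_dm_ltr a v : delta (dm (ltr a) v) =
  sweedler (fun v1 v2 => dm (ltr a) v1 \ox v2) (delta v).
Proof.
apply: (malg_ext (f := fun v => delta (dm (ltr a) v))
    (g := fun v => sweedler (fun v1 v2 => dm (ltr a) v1 \ox v2) (delta v))) v
  => [c x y|c x y|[[|b [|d t]]]].
- by rewrite dmPr deltaP.
- by rewrite deltaP sweedlerP.
- by rewrite dm1r delta_ltr delta0 sweedler0.
- by rewrite -lconsU dm_ltr_lcons !delta_ltr sweedler0.
rewrite sweedler_delta_lcons -[wd [:: b, d & t]]lconsU !dm_ltr_lcons.
rewrite (delta_lcons _ (augU d t)).
apply: (f_equal2 +%R); last by [].
apply: eq_sweedler_delta => b' s' d' t'.
by rewrite dm_ltr_lcons.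
Qed.

(** By induction on w: a cut of w <> v on the left of the contracted letter is a
    cut of w, a cut on the right of it is a cut of v. *)
Lemma delta_dm w v : delta (dm w v) =
  sweedler (fun v1 v2 => dm w v1 \ox v2) (delta v)
  + sweedler (fun w1 w2 => w1 \ox dm w2 v) (delta w).
Proof.
apply: (malg_ext (f := fun w => delta (dm w v))
  (g := fun w => sweedler (fun v1 v2 => dm w v1 \ox v2) (delta v)
    + sweedler (fun w1 w2 => w1 \ox dm w2 v) (delta w))) w => [c x y|c x y|[s]].
- by rewrite dmPl deltaP.
- move: c x y; apply: linear_add => c x y.
    by apply: sweedler_lin => u1 u2; rewrite dmPl tensorPl.
  by rewrite deltaP sweedlerP.
elim: s => [|a [|b s] IHs].
- rewrite dm1l delta0 [X in _ + X]sweedler0 [RHS]addr0 -[LHS]sweedler_tensor.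
  by apply: eq_sweedler_delta => a' s' b' t'; rewrite dm1l.
- by rewrite -lconsU delta_dm_ltr delta_ltr [X in _ + X]sweedler0 [RHS]addr0.
have s0 := augU b s; have sv0 : aug (dm (wd (b :: s)) v) by exact: aug_dm.
have E : delta (dm (wd [:: a, b & s]) v) =
    sweedler (fun y1 y2 => lcons << a >> y1 \ox y2) (delta (dm (wd (b :: s)) v))
      + ltr << a >> \ox dm (wd (b :: s)) v.
  by rewrite -lconsU (dm_lcons _ _ s0) (delta_lcons _ sv0).
rewrite [LHS]E IHs.
rewrite [X in _ = _ + X]sweedler_delta_lcons.
rewrite [X in X + _ = _]sweedlerD.
rewrite -[LHS]addrA.
have lconsT : linear (sweedler (fun y1 y2 : kW => lcons << a >> y1 \ox y2)).
  exact: sweedlerP.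
apply: (f_equal2 +%R).
  rewrite [LHS](sweedler_comp _ _ lconsT); apply: eq_sweedler_delta => a' s' b' t'.
  by rewrite sweedler_lcons -[wd [:: a, b & s]]lconsU (dm_lcons _ _ s0).
apply: (f_equal2 +%R); last by [].
rewrite [LHS](sweedler_comp _ _ lconsT); apply: eq_sweedler_delta => a' s' b' t'.
by rewrite sweedler_lcons.
Qed.

Lemma delta_coassoc w :
  sweedler (fun x y => sweedler (fun x1 x2 => x1 \ox x2 \ox y) (delta x)) (delta w) =
  sweedler (fun x y => sweedler (fun y1 y2 => x \ox y1 \ox y2) (delta y)) (delta w).
Proof.
apply: (malg_ext
  (f := fun w => sweedler (fun x y =>
     sweedler (fun x1 x2 => x1 \ox x2 \ox y) (delta x)) (delta w))
  (g := fun w => sweedler (fun x y =>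
     sweedler (fun y1 y2 => x \ox y1 \ox y2) (delta y)) (delta w))) w
  => [c x y|c x y|[s]]; [by rewrite deltaP sweedlerP | by rewrite deltaP sweedlerP |].
(* The word s cut before its positions j < i. *)
pose F i j : {malg k[(word * word * word)%type]} := << (FMonom (take j s),
  FMonom (drop j (take i s)), FMonom (drop i s)) >>.
transitivity (\sum_(1 <= i < size s) \sum_(1 <= j < i) F i j).
  rewrite [delta _]deltaU sweedler_sum; apply: eq_big_nat => i /andP[_ lti].
  rewrite sweedlerU [delta _]deltaU sweedler_sum size_takel ?(ltnW lti) //.
  apply: eq_big_nat => j /andP[_ ltji].
  by rewrite sweedlerU !tensorU take_takel ?(ltnW ltji).
rewrite big_triangle [delta _]deltaU sweedler_sum.
apply: eq_big_nat => j /andP[_ ltj].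
rewrite sweedlerU [delta _]deltaU sweedler_sum size_drop.
apply: eq_big_nat => l /andP[_ ltl].
by rewrite sweedlerU !tensorU /F take_drop drop_drop addnC.
Qed.

(** * The antipode *)

(** A linear map T is determined by its values on words of length at most one and
    the recursion T2; the inverse of Sigma is this map. *)
Section Antipode.
Variable T : kW -> kW.
Hypothesis TP : linear T.
Hypothesis T0 : T (wd [::]) = wd [::].
Hypothesis T1 : forall a, T (wd [:: a]) = wd [:: a].
Hypothesis T2 : forall a b s, T (wd [:: a, b & s]) =
  lcons << a >> (T (wd (b :: s))) - dm (ltr << a >>) (T (wd (b :: s))).

Lemma aug_T b s : aug (T (wd (b :: s))).
Proof.
elim: s b => [|d s IHs] b; first by rewrite T1; apply: augU.
rewrite T2 /aug mcoeffB [X in X - _]aug_lcons [X in _ - X]aug_dm ?subr0 //.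
exact: aug_lcons.
Qed.

Lemma dmBl x y z : dm (x - y) z = dm x z - dm y z.
Proof. by rewrite unlock linearBl. Qed.

Lemma dmNl x y : dm (- x) y = - dm x y.
Proof. by rewrite unlock linearNl. Qed.

Lemma dmNr x y : dm x (- y) = - dm x y.
Proof. by rewrite unlock linearNr. Qed.

Lemma delta1 a : delta (wd [:: a]) = 0.
Proof. by rewrite -lconsU delta_ltr. Qed.

(** The cut after the first letter a of w contributes a <> T u, which cancels the
    correction term of T (a.u). *)
Lemma antipode_right w : T w + sweedler (fun x y => dm x (T y)) (delta w) = w.
Proof.
apply: (malg_ext (f := fun w => T w + sweedler (fun x y => dm x (T y)) (delta w))
  (g := id)) w => [||[s]] //.
  by apply: linear_add => // c x y; rewrite deltaP sweedlerP.
elim: s => [|a [|b s] IHs].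
- by rewrite T0 delta0 [X in _ + X]sweedler0 addr0.
- by rewrite T1 delta1 [X in _ + X]sweedler0 addr0.
have LP : linear (lcons << a >>) by move=> c x y; exact: lconsPr.
rewrite T2 [X in _ + X]sweedler_delta_lcons subDDK.
transitivity (lcons << a >> (T (wd (b :: s)) +
    sweedler (fun x y => dm x (T y)) (delta (wd (b :: s))))); last first.
  by rewrite IHs lconsU.
rewrite [RHS](lin_add LP) [X in _ = _ + X](sweedler_comp _ _ LP).
apply: (f_equal2 +%R); first by [].
by apply: eq_sweedler_delta => c t d u; rewrite dm_lcons //; apply: augU.
Qed.

(** Here the correction term also appears inside the sum, so that the recursion
    for T is treated as one linear map phi, which commutes with right
    multiplication on the augmentation ideal. *)
Lemma antipode_left w : T w + sweedler (fun x y => dm (T x) y) (delta w) = w.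
Proof.
apply: (malg_ext (f := fun w => T w + sweedler (fun x y => dm (T x) y) (delta w))
  (g := id)) w => [||[s]] //.
  by apply: linear_add => // c x y; rewrite deltaP sweedlerP.
elim: s => [|a [|b s] IHs].
- by rewrite T0 delta0 [X in _ + X]sweedler0 addr0.
- by rewrite T1 delta1 [X in _ + X]sweedler0 addr0.
(* T (a.u) = phi (T u), and phi u + a <> u = a.u. *)
pose phi u := lcons << a >> u - dm (ltr << a >>) u.
have phiP : linear phi.
  by apply: linear_sub => c x y; [apply: lconsPr | apply: dmPr].
rewrite [X in _ + X]sweedler_delta_lcons [X in dm (T X)]lconsU T1 T2.
rewrite -[X in X + _]/(phi _) [LHS]addrA.
transitivity (phi (wd (b :: s)) + dm (wd [:: a]) (wd (b :: s))); last first.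
  by rewrite -[wd [:: a]]lconsU /phi subrK lconsU.
apply: (f_equal2 +%R); last by [].
rewrite -[X in _ = phi X]IHs [RHS](lin_add phiP); apply: (f_equal2 +%R); first by [].
rewrite [RHS](sweedler_comp _ _ phiP); apply: eq_sweedler_delta => c t d u.
rewrite lconsU T2 dmBl /phi dm_lcons; last exact: aug_T.
by rewrite -dm_ltrA.
Qed.

End Antipode.

End Diamond.

(** * The inverse of Sigma *)

Section SigmaInv.
Variables (k : fieldType) (A : countType).
Variable dia : {bilinear {malg k[A]} -> {malg k[A]} -> {malg k[A]}}.
Hypothesis diaA : associative dia.
Local Notation T := (Sigma_inv dia).
Local Notation wd s := (<< FMonom s >> : {malg k[{fmonom A}]}).

Lemma Sigma_inv_nil : T (wd [::]) = wd [::].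
Proof. by rewrite -[T]/(Defs.Sg dia (-1)) Defs.U1; exact: Defs.Sg1. Qed.

Lemma Sigma_inv_letter a : T (wd [:: a]) = wd [:: a].
Proof. by rewrite -[T]/(Defs.Sg dia (-1)) -Defs.ltrU; exact: Defs.Sg_ltr. Qed.

Lemma Sigma_inv_cons a b s : T (wd [:: a, b & s]) =
  lcons << a >> (T (wd (b :: s))) -
  dmul dia (lcons << a >> (wd [::])) (T (wd (b :: s))).
Proof.
rewrite -[T]/(Defs.Sg dia (-1)) Defs.Sg_cons2 // scaleN1r -ltrE !unlock.
by [].
Qed.

End SigmaInv.

Theorem theorem4p3 (k : fieldType) (char_k0 : [pchar k] =i pred0)
    (A : countType)
    (dia : {bilinear {malg k[A]} -> {malg k[A]} -> {malg k[A]}})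
    (diaA : associative dia) (diaC : commutative dia) :
  infinitesimal_hopf (diamond dia) (rdeconcat k A) /\
  is_antipode (diamond dia) (rdeconcat k A) (\- Sigma_inv dia).
Proof.
have antipode : is_antipode (diamond dia) (rdeconcat k A) (\- Sigma_inv dia).
  move=> w; split.
    have : sweedler (fun x y => dmul dia (- Sigma_inv dia x) y) (cuts w)
        + - Sigma_inv dia w + w = 0.
      rewrite (eq_sweedler (fun x y => dmNl dia (Sigma_inv dia x) y)) sweedlerN
        -opprD [in X in - X]addrC.
      by rewrite (antipode_left diaA (linearP (Sigma_inv dia)) (Sigma_inv_nil dia)
        (Sigma_inv_letter dia) (Sigma_inv_cons diaA)) addNr.
    by rewrite !unlock.
  have : sweedler (fun x y => dmul dia x (- Sigma_inv dia y)) (cuts w)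
      + w + - Sigma_inv dia w = 0.
    rewrite (eq_sweedler (fun x y => dmNr dia x (Sigma_inv dia y))) sweedlerN
      addrAC -opprD [in X in - X]addrC.
    by rewrite (antipode_right (linearP (Sigma_inv dia)) (Sigma_inv_nil dia)
      (Sigma_inv_letter dia) (Sigma_inv_cons diaA)) addNr.
  by rewrite !unlock.
split; last exact: antipode.
apply: InfinitesimalHopf.
- by have := diamondA diaA; rewrite unlock.
- by have := @delta_coassoc k A; rewrite !unlock.
- by have := @delta_dm k A dia; rewrite !unlock.
- by exists (\- Sigma_inv dia); exact: antipode.
Qed.
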